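(* Let $\lambda\in\mathbb{R}$. For every integer $n\ge 0$ and every real $x$, $$e^{x}\phi_{n,\lambda}(x)=e^{x}\sum_{k=0}^{n}{n \brace k}_{\lambda}x^{k}=\sum_{j=0}^{\infty}\frac{(j)_{n,\lambda}}{j!}x^{j}.$$
   Context: For $\lambda\in\mathbb{R}$, the degenerate falling factorials are $(x)_{0,\lambda}=1$ and $(x)_{n,\lambda}=x(x-\lambda)(x-2\lambda)\cdots(x-(n-1)\lambda)$ for $n\ge 1$; the falling factorials are $(x)_0=1$, $(x)_n=x(x-1)\cdots(x-n+1)$ for $n\ge1$. The degenerate Stirling numbers of the second kind ${n \brace k}_{\lambda}$ ($0\le k\le n$) are defined by the polynomial identity $(x)_{n,\lambda}=\sum_{k=0}^{n}{n \brace k}_{\lambda}(x)_k$, $n\ge 0$. The degenerate Bell polynomials are $\phi_{n,\lambda}(x)=\sum_{k=0}^{n}{n \brace k}_{\lambda}x^{k}$, $n\ge 0$. *)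

(* Defs.v *)
From mathcomp Require Import all_boot all_order all_algebra.
From mathcomp Require Import all_classical all_reals all_analysis.

Set Implicit Arguments.
Unset Strict Implicit.
Unset Printing Implicit Defensive.

Import GRing.Theory.
Local Open Scope ring_scope.

(* The two products make sense in any ring, so that they can be used both for
   the polynomial indeterminate 'X and for real numbers. *)

(* (x)_{n,l} = x (x - l) (x - 2 l) ... (x - (n - 1) l) *)
Definition degenerate_falling (A : pzRingType) (l x : A) (n : nat) : A :=
  \prod_(i < n) (x - l *+ i).

(* (x)_n = x (x - 1) ... (x - n + 1) *)
Definition falling (A : pzRingType) (x : A) (n : nat) : A :=
  \prod_(i < n) (x - i%:R).

(* c lists the coefficients of (x)_{n,l} in the basis of falling factorials;
   they only have a meaning for k <= n, the others are set to 0. *)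
Definition is_degenerate_stirling2 (R : realType) (l : R) (n : nat)
    (c : nat -> R) : Prop :=
  degenerate_falling l%:P 'X n = \sum_(k < n.+1) c k *: falling 'X k
  /\ (forall k, (n < k)%N -> c k = 0).

Lemma degenerate_stirling2_exists (R : realType) (l : R) (n : nat) :
  exists c : nat -> R, is_degenerate_stirling2 l n c.
Proof.
elim: n => [|n [c [cE c0]]].
  exists (fun k => (k == 0%N)%:R); split=> [|[]//].
  by rewrite big_ord1 /degenerate_falling /falling !big_ord0 scale1r.
exists (fun k => (if k is k'.+1 then c k' else 0) + (k%:R - l *+ n) * c k).
split=> [|[//|k] nk]; last first.
  by rewrite !c0 ?mulr0 ?addr0 // ltnW.
have step k : falling 'X k * ('X - l%:P *+ n) =
    falling 'X k.+1 + (k%:R - l *+ n) *: falling 'X k :> {poly R}.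
  rewrite /falling big_ord_recr /= -mul_polyC [_%:P * _]mulrC -mulrDr.
  by rewrite polyCB !polyCMn polyC1 addrA subrK.
rewrite /degenerate_falling big_ord_recr /=.
rewrite -[\prod_(i < n) _]/(degenerate_falling _ _ n) cE mulr_suml.
under [LHS]eq_bigr do rewrite -scalerAl step scalerDr scalerA mulrC.
under [RHS]eq_bigr do rewrite scalerDl.
rewrite !big_split /=; congr (_ + _).
  by rewrite [RHS]big_ord_recl scale0r add0r.
by rewrite [RHS]big_ord_recr /= c0 // mulr0 scale0r addr0.
Qed.

Lemma degenerate_stirling2_unique (R : realType) (l : R) (n : nat)
    (c d : nat -> R) :
  is_degenerate_stirling2 l n c -> is_degenerate_stirling2 l n d -> c =1 d.
Proof.
move=> [cE c0] [dE d0].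
have szf k : size (falling 'X k : {poly R}) = k.+1.
  rewrite /falling; under eq_bigr do rewrite -polyC_natr.
  by rewrite size_prod_XsubC -[index_enum _]enumT size_enum_ord.
have szs (e : nat -> R) m :
    (size (\sum_(k < m) e k *: falling 'X k : {poly R})%R <= m)%N.
  apply: (leq_trans (size_sum _ _ _)); apply/bigmax_leqP => i _.
  by rewrite (leq_trans (size_scale_leq _ _)) ?szf.
have free (e : nat -> R) m : \sum_(k < m) e k *: falling 'X k = 0 :> {poly R} ->
    forall k, (k < m)%N -> e k = 0.
  elim: m => // m IH; rewrite big_ord_recr /= => E.
  have em : e m = 0.
    have := congr1 (fun p : {poly R} => p`_m) E.
    rewrite coefD coef0 nth_default ?szs // add0r coefZ => /eqP.
    have: (falling 'X m : {poly R})`_m != 0.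
      by have := lead_coef_eq0 (falling 'X m : {poly R});
         rewrite lead_coefE szf /= -size_poly_eq0 szf => ->.
    by rewrite mulf_eq0 => /negPf -> /[!orbF] /eqP.
  move=> k; rewrite ltnS leq_eqVlt => /predU1P[->//|]; apply: IH.
  by move: E; rewrite em scale0r addr0.
move=> k; have [nk|kn] := ltnP n k; first by rewrite c0 ?d0.
apply/eqP; rewrite -subr_eq0; apply/eqP.
apply: (free (fun k => c k - d k) n.+1) => //.
under eq_bigr do rewrite scalerBl.
by rewrite sumrB -cE -dE subrr.
Qed.

Definition degenerate_stirling2 (R : realType) (l : R) (n : nat) : nat -> R :=
  sval (cid (degenerate_stirling2_exists l n)).

Lemma degenerate_stirling2P (R : realType) (l : R) (n : nat) :
  is_degenerate_stirling2 l n (degenerate_stirling2 l n).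
Proof. exact: svalP (cid (degenerate_stirling2_exists l n)). Qed.

Definition degenerate_bell (R : realType) (l : R) (n : nat) : {poly R} :=
  \sum_(k < n.+1) degenerate_stirling2 l n k *: 'X^k.

(* Main.v *)
Require Import Defs.
From mathcomp Require Import all_boot all_order all_algebra.
From mathcomp Require Import all_classical all_reals all_analysis.
Import GRing.Theory Num.Theory numFieldNormedType.Exports.
Local Open Scope classical_set_scope.
Local Open Scope ring_scope.

(** The identity defining the degenerate Stirling numbers is a polynomial
    identity, so it can be evaluated at each natural number [j]: this writes
    [(j)_{n,lambda}] as the finite combination of the ordinary falling
    factorials [(j)_k] with coefficients the Stirling numbers
    ([degenerate_falling_stirling2]).  Since limits of series are linear, it
    remains to sum [(j)_k x^j / j!] over [j] for a fixed [k]
    ([cvg_series_falling]).  Its terms vanish for [j < k], because [(j)_k] then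
    contains the factor [j - j]; for [j = m + k] one has [(j)_k / j! = 1 / m!],
    so what is left is [x^k] times the exponential series. *)

Lemma falling_natr (A : pzRingType) (j k : nat) :
  falling (j%:R : A) k = (j ^_ k)%:R.
Proof.
elim: k => [|k IH]; first by rewrite /falling big_ord0.
rewrite /falling big_ord_recr /= -[\prod_(i < k) _]/(falling _ k) IH.
rewrite ffactnSr natrM; case: (leqP k j) => [kj|jk]; first by rewrite natrB.
by rewrite ffact_small // !mul0r.
Qed.

Lemma horner_degenerate_falling (A : comNzRingType) (l y : A) (n : nat) :
  (degenerate_falling l%:P 'X n).[y] = degenerate_falling l y n.
Proof.
by rewrite horner_prod; apply: eq_bigr => i _; rewrite -polyCMn hornerXsubC.
Qed.

Lemma horner_falling (A : comNzRingType) (y : A) (n : nat) :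
  (falling 'X n).[y] = falling y n.
Proof.
by rewrite horner_prod; apply: eq_bigr => i _; rewrite -polyC_natr hornerXsubC.
Qed.

Lemma degenerate_falling_stirling2 (R : realType) (l y : R) (n : nat) :
  degenerate_falling l y n =
    \sum_(k < n.+1) degenerate_stirling2 l n k * falling y k.
Proof.
have [E _] := degenerate_stirling2P l n.
rewrite -horner_degenerate_falling E horner_sum.
by apply: eq_bigr => k _; rewrite hornerZ horner_falling.
Qed.

(** The partial sum of length [m + k] is [x ^+ k] times the partial sum of
    length [m] of the exponential series, because the first [k] terms vanish
    and [(i + k) ^_ k * i`! = (i + k)`!]. *)
Lemma cvg_series_falling (R : realType) (x : R) (k : nat) :
  series (fun j : nat => falling (j%:R : R) k / j`!%:R * x ^+ j) @ \oo -->
    expR x * x ^+ k.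
Proof.
rewrite -(cvg_shiftn k).
have -> : (fun m => series
      (fun j : nat => falling (j%:R : R) k / j`!%:R * x ^+ j) (m + k)%N) =
    (fun m => series (exp_coeff x) m * x ^+ k).
  apply/funext => m; rewrite /series /=.
  rewrite (big_cat_nat (n := k)) ?leq_addl //= big_nat big1 ?add0r; last first.
    by move=> j /andP[_ jk]; rewrite falling_natr ffact_small // !mul0r.
  rewrite -{1}[k]add0n big_addn addnK mulr_suml; apply: eq_bigr => i _.
  rewrite falling_natr -(ffact_fact (leq_addl i k)) addnK natrM exprD /exp_coeff.
  rewrite /= mulrA; congr (_ * _); rewrite mulrC; congr (_ * _).
  rewrite invfM mulrA divff ?mul1r //.
  by rewrite pnatr_eq0 -lt0n ffact_gt0 leq_addl.
by apply: cvgMr_tmp; exact: is_cvg_series_exp_coeff.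
Qed.

Theorem theorem2p3 (R : realType) (lambda : R) (n : nat) (x : R) :
  expR x * (degenerate_bell lambda n).[x] =
    expR x * (\sum_(k < n.+1) degenerate_stirling2 lambda n k * x ^+ k)
  /\
  series (fun j : nat =>
      degenerate_falling lambda j%:R n / (j`!)%:R * x ^+ j) @ \oo -->
    expR x * (\sum_(k < n.+1) degenerate_stirling2 lambda n k * x ^+ k).
Proof.
split.
  rewrite /degenerate_bell horner_sum; congr (_ * _); apply: eq_bigr => k _.
  by rewrite hornerZ hornerXn.
have -> : series (fun j : nat =>
      degenerate_falling lambda j%:R n / j`!%:R * x ^+ j) =
    (fun m => \sum_(k < n.+1) degenerate_stirling2 lambda n k *
      series (fun j : nat => falling (j%:R : R) k / j`!%:R * x ^+ j) m).
  apply/funext => m; rewrite /series /=.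
  under [RHS]eq_bigr do rewrite mulr_sumr.
  rewrite exchange_big /=; apply: eq_bigr => j _.
  rewrite degenerate_falling_stirling2 !mulr_suml.
  by apply: eq_bigr => k _; rewrite !mulrA.
rewrite mulr_sumr; under eq_bigr do rewrite mulrCA.
apply: cvg_big => [|k _]; first exact: add_continuous.
by apply: cvgMl_tmp; exact: cvg_series_falling.
Qed.
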